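(* Let $X$ be a locally compact Hausdorff space such that the topologies on all its compact subsets are metrisable, let $\Omega$ be the Borel $\sigma$-algebra of $X$, and let $\mu\colon\Omega\to[0,\infty]$ be a measure (no regularity is assumed). Let $j\colon \mathrm{C}_{\mathrm{c}}(X)\to \mathrm{L}^0(X,\Omega,\mu)$ denote the canonical map, sending $f$ to its equivalence class $[f]$. Suppose that $E$ is a Banach function space over $(X,\Omega,\mu)$ such that $j(\mathrm{C}_{\mathrm{c}}(X))$ is contained in $E$ and dense in $E$. Then $E$ is order continuous.
   Context: All functions and vector spaces are real. $\mathrm{L}^0(X,\Omega,\mu)$ is the ($\sigma$-Dedekind complete) vector lattice of $\Omega$-measurable functions on $X$, with identification of two functions when they agree $\mu$-almost everywhere; $[f]$ is the equivalence class of $f$. A Banach function space over $(X,\Omega,\mu)$ is an ideal in $\mathrm{L}^0(X,\Omega,\mu)$ that is supplied with a norm in which it is a Banach lattice. $\mathrm{C}_{\mathrm{c}}(X)$ is the space of continuous compactly supported functions on $X$. A Banach lattice is called order continuous if its norm is order continuous. *)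

(* Defs.v *)
From HB Require Import structures.
From mathcomp Require Import all_boot all_order all_algebra.
From mathcomp Require Import all_classical all_reals all_analysis.
From mathcomp Require Import measurable_realfun hoelder.
Set Implicit Arguments.
Unset Strict Implicit.
Unset Printing Implicit Defensive.
Import Order.TTheory GRing.Theory Num.Theory.
Import numFieldNormedType.Exports.
Local Open Scope classical_set_scope.
Local Open Scope ring_scope.

Section L0.
Context {d : measure_display} {T : measurableType d} {R : realType}.
Variable mu : {measure set T -> \bar R}.

Definition L0 : Type := {mfun_ mu, T >-> R}.

HB.instance Definition _ := Choice.on L0.

Definition L0_class (f : {mfun T >-> R}) : L0 := (\pi_({mfun_ mu, T >-> R}) f)%qT.

Definition L0_fun (x : L0) : {mfun T >-> R} := repr (x : {mfun_ mu, T >-> R}).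

Lemma L0_classP (f g : {mfun T >-> R}) :
  L0_class f = L0_class g <-> (\forall t \ae mu, f t = g t).
Proof.
rewrite /L0_class; split=> [/eqP|fg].
  rewrite eqmodE => /asboolP; apply: filterS => t /=; exact.
by apply/eqP; rewrite eqmodE; apply/asboolP; apply: filterS fg.
Qed.

Lemma L0_funK (x : L0) : L0_class (L0_fun x) = x.
Proof. exact: reprK. Qed.

Lemma L0_classK (f : {mfun T >-> R}) : \forall t \ae mu, L0_fun (L0_class f) t = f t.
Proof. by apply/L0_classP; rewrite L0_funK. Qed.

Definition L0_zero : L0 := L0_class 0.
Definition L0_opp (x : L0) : L0 := L0_class (- L0_fun x).
Definition L0_add (x y : L0) : L0 := L0_class (L0_fun x + L0_fun y).
Definition L0_scale (a : R) (x : L0) : L0 := L0_class (a *: L0_fun x).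
Definition L0_le (x y : L0) : bool :=
  `[< \forall t \ae mu, L0_fun x t <= L0_fun y t >].
Definition L0_meet (x y : L0) : L0 := L0_class (min_mfun (L0_fun x) (L0_fun y)).
Definition L0_join (x y : L0) : L0 := L0_class (max_mfun (L0_fun x) (L0_fun y)).

Lemma L0_eqP (x y : L0) : (\forall t \ae mu, L0_fun x t = L0_fun y t) -> x = y.
Proof. by move/L0_classP; rewrite !L0_funK. Qed.

Lemma L0_addE (x y : L0) :
  \forall t \ae mu, L0_fun (L0_add x y) t = L0_fun x t + L0_fun y t.
Proof. exact: L0_classK. Qed.

Lemma L0_oppE (x : L0) : \forall t \ae mu, L0_fun (L0_opp x) t = - L0_fun x t.
Proof. exact: L0_classK. Qed.

Lemma L0_zeroE : \forall t \ae mu, L0_fun L0_zero t = 0.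
Proof. exact: L0_classK. Qed.

Lemma L0_scaleE (a : R) (x : L0) :
  \forall t \ae mu, L0_fun (L0_scale a x) t = a * L0_fun x t.
Proof. exact: L0_classK. Qed.

Lemma L0_joinE (x y : L0) : \forall t \ae mu,
  L0_fun (L0_join x y) t = Num.max (L0_fun x t) (L0_fun y t).
Proof. exact: L0_classK. Qed.

Lemma L0_meetE (x y : L0) : \forall t \ae mu,
  L0_fun (L0_meet x y) t = Num.min (L0_fun x t) (L0_fun y t).
Proof. exact: L0_classK. Qed.

Let addA : associative L0_add.
Proof.
move=> x y z; apply: L0_eqP.
have h1 := L0_addE x (L0_add y z); have h2 := L0_addE y z.
have h3 := L0_addE (L0_add x y) z; have h4 := L0_addE x y.
by near=> t; rewrite (near h1 t)// (near h2 t)// (near h3 t)// (near h4 t)// addrA.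
Unshelve. all: end_near. Qed.

Let addC : commutative L0_add.
Proof. by move=> x y; rewrite /L0_add addrC. Qed.

Let add0 : left_id L0_zero L0_add.
Proof.
move=> x; apply: L0_eqP; have h1 := L0_addE L0_zero x; have h2 := L0_zeroE.
by near=> t; rewrite (near h1 t)// (near h2 t)// add0r.
Unshelve. all: end_near. Qed.

Let addN : left_inverse L0_zero L0_opp L0_add.
Proof.
move=> x; apply: L0_eqP; have h1 := L0_addE (L0_opp x) x.
have h2 := L0_zeroE; have h3 := L0_oppE x.
by near=> t; rewrite (near h1 t)// (near h2 t)// (near h3 t)// addNr.
Unshelve. all: end_near. Qed.

HB.instance Definition _ := GRing.isZmodule.Build L0 addA addC add0 addN.

Let scaleA (a b : R) (x : L0) : L0_scale a (L0_scale b x) = L0_scale (a * b) x.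
Proof.
apply: L0_eqP; have h1 := L0_scaleE a (L0_scale b x); have h2 := L0_scaleE b x.
have h3 := L0_scaleE (a * b) x.
by near=> t; rewrite (near h1 t)// (near h2 t)// (near h3 t)// mulrA.
Unshelve. all: end_near. Qed.

Let scale1 : left_id 1 L0_scale.
Proof. by move=> x; rewrite /L0_scale scale1r L0_funK. Qed.

Let scaleDr : right_distributive L0_scale +%R.
Proof.
move=> a x y; apply: L0_eqP; have h1 := L0_scaleE a (L0_add x y).
have h2 := L0_addE x y; have h3 := L0_addE (L0_scale a x) (L0_scale a y).
have h4 := L0_scaleE a x; have h5 := L0_scaleE a y.
near=> t; rewrite [LHS](near h1 t)// (near h2 t)// [RHS](near h3 t)//.
by rewrite (near h4 t)// (near h5 t)// mulrDr.
Unshelve. all: end_near. Qed.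

Let scaleDl (x : L0) : {morph L0_scale^~ x : a b / a + b}.
Proof.
move=> a b; apply: L0_eqP; have h1 := L0_scaleE (a + b) x.
have h2 := L0_scaleE a x; have h3 := L0_scaleE b x.
have h4 := L0_addE (L0_scale a x) (L0_scale b x).
near=> t; rewrite [LHS](near h1 t)// [RHS](near h4 t)//.
by rewrite (near h2 t)// (near h3 t)// mulrDl.
Unshelve. all: end_near. Qed.

HB.instance Definition _ :=
  GRing.Zmodule_isLmodule.Build R L0 scaleA scale1 scaleDr scaleDl.

Let le_refl : reflexive L0_le.
Proof. by move=> x; apply/asboolP; near=> t. Unshelve. all: end_near. Qed.

Let le_anti : antisymmetric L0_le.
Proof.
move=> x y /andP[/asboolP xy /asboolP yx]; apply: L0_eqP; near=> t.
by apply/eqP; rewrite eq_le (near xy t)// (near yx t).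
Unshelve. all: end_near. Qed.

Let le_trans : transitive L0_le.
Proof.
move=> y x z /asboolP xy /asboolP yz; apply/asboolP; near=> t.
by apply: (le_trans (near xy t _)) => //; exact: (near yz t).
Unshelve. all: end_near. Qed.

(* The order uses [ring_display], so that [<=] is the notation of [ring_scope];
   the pointwise supremum of two classes is [Order.join]. *)
HB.instance Definition _ :=
  Order.Le_isPOrder.Build ring_display L0 le_refl le_anti le_trans.

Let lexI (x y z : L0) : (x <= L0_meet y z) = (x <= y) && (x <= z).
Proof.
have h := L0_meetE y z; apply/asboolP/andP => [xyz|[/asboolP xy /asboolP xz]].
  by split; apply/asboolP; near=> t; have := near xyz t;
    rewrite (near h t)// le_min => /(_ _)/andP[].
near=> t; rewrite (near h t)// le_min; apply/andP; split.
  by near: t.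
by near: t.
Unshelve. all: end_near. Qed.

Let leUx (x y z : L0) : (L0_join x y <= z) = (x <= z) && (y <= z).
Proof.
have h := L0_joinE x y; apply/asboolP/andP => [xyz|[/asboolP xz /asboolP yz]].
  by split; apply/asboolP; near=> t; have := near xyz t;
    rewrite (near h t)// ge_max => /(_ _)/andP[].
near=> t; rewrite (near h t)// ge_max; apply/andP; split.
  by near: t.
by near: t.
Unshelve. all: end_near. Qed.

HB.instance Definition _ :=
  Order.POrder_isMeetSemilattice.Build ring_display L0 lexI.
HB.instance Definition _ :=
  Order.POrder_isJoinSemilattice.Build ring_display L0 leUx.

Lemma L0_leD2r (z x y : L0) : x <= y -> x + z <= y + z.
Proof.
move=> /asboolP xy; apply/asboolP.
have h1 := L0_addE x z; have h2 := L0_addE y z.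
near=> t; rewrite [leLHS](near h1 t)// [leRHS](near h2 t)// lerD2r.
by near: t.
Unshelve. all: end_near. Qed.

Lemma L0_scaler_ge0 (a : R) (x : L0) : 0 <= a -> 0 <= x -> 0 <= a *: x.
Proof.
move=> a0 /asboolP x0; apply/asboolP.
have h1 := L0_scaleE a x; have h2 := L0_zeroE.
near=> t; rewrite [leLHS](near h2 t)// [leRHS](near h1 t)// mulr_ge0//.
rewrite -[leLHS](near h2 t)//.
by near: t.
Unshelve. all: end_near. Qed.

End L0.

Section function_spaces.
Context {d : measure_display} {T : measurableType d} {R : realType}.
Context {mu : {measure set T -> \bar R}}.
Implicit Types (E : set (L0 mu)) (N : L0 mu -> R).

Definition L0_abs (x : L0 mu) : L0 mu := Order.join x (- x).

Definition is_ideal E : Prop :=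
  [/\ E 0,
      forall (a : R) (x y : L0 mu), E x -> E y -> E (a *: x + y)
    & forall x y : L0 mu, E x -> L0_abs y <= L0_abs x -> E y].

(* The norm [N] of a subspace [E] is a total function on [L0 mu], but only its
   values on [E] matter: those outside [E] are junk. *)
Definition is_lattice_norm E N : Prop :=
  [/\ forall x, E x -> 0 <= N x,
      forall x, E x -> N x = 0 -> x = 0,
      forall (a : R) x, E x -> N (a *: x) = `|a| * N x,
      forall x y, E x -> E y -> N (x + y) <= N x + N y
    & forall x y, E x -> E y -> L0_abs x <= L0_abs y -> N x <= N y].

Definition norm_complete E N : Prop :=
  forall u : nat -> L0 mu, (forall n, E (u n)) ->
    (forall e : R, 0 < e -> exists n0 : nat, forall m n : nat,
        (n0 <= m)%N -> (n0 <= n)%N -> N (u m - u n) < e) ->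
    exists2 x, E x & (fun n => N (u n - x)) @ \oo --> (0 : R).

Definition is_dense_in E N (D : set (L0 mu)) : Prop :=
  forall x, E x -> forall e : R, 0 < e -> exists2 y, D y & N (x - y) < e.

Definition directed_preorder (I : Type) (r : I -> I -> Prop) : Prop :=
  [/\ exists i : I, True,
      forall i, r i i,
      forall i j k, r i j -> r j k -> r i k
    & forall i j, exists k, r i k /\ r j k].

(* [x] is a net in [E] that decreases to [0], the infimum being taken in [E]. *)
Definition net_decreases_to0 E (I : Type) (r : I -> I -> Prop) (x : I -> L0 mu) :
    Prop :=
  [/\ forall i, E (x i),
      forall i j, r i j -> x j <= x i,
      forall i, 0 <= x i
    & forall y, E y -> (forall i, y <= x i) -> y <= 0].

Definition order_continuous_norm E N : Prop :=
  forall (I : Type) (r : I -> I -> Prop) (x : I -> L0 mu),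
    directed_preorder r -> net_decreases_to0 E r x ->
    forall e : R, 0 < e -> exists i0, forall i, r i0 i -> N (x i) < e.

End function_spaces.

(* An ideal [bfs_set] of L^0 with a norm in which it is a Banach lattice. *)
Record banachFunctionSpace {d : measure_display} {T : measurableType d}
    {R : realType} (mu : {measure set T -> \bar R}) := BanachFunctionSpace {
  bfs_set :> set (L0 mu) ;
  bfs_norm : L0 mu -> R ;
  bfs_ideal : is_ideal bfs_set ;
  bfs_lattice_norm : is_lattice_norm bfs_set bfs_norm ;
  bfs_complete : norm_complete bfs_set bfs_norm
}.

Definition order_continuous {d : measure_display} {T : measurableType d}
    {R : realType} {mu : {measure set T -> \bar R}}
    (E : banachFunctionSpace mu) : Prop :=
  order_continuous_norm E (bfs_norm E).

Definition metrizable (R : realType) (T : topologicalType) : Prop :=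
  exists rho : T -> T -> R,
    [/\ forall x, rho x x = 0,
        forall x y, rho x y = 0 -> x = y,
        forall x y, rho x y = rho y x,
        forall x y z, rho x z <= rho x y + rho y z
      & forall (x : T) (U : set T), nbhs x U <->
          exists2 e : R, 0 < e & [set y | rho x y < e] `<=` U].

(* The measurable spaces of the library are pointed, hence a
   [ptopologicalType]: only the empty space is left out. *)
Definition borel (X : ptopologicalType) := g_sigma_algebraType (@open X).

HB.instance Definition _ (X : ptopologicalType) := Measurable.on (borel X).

Record Cc (X : topologicalType) (R : realType) := MkCc {
  Cc_fun :> X -> R ;
  Cc_continuous : continuous Cc_fun ;
  Cc_compact_support : compact (closure [set x | Cc_fun x != 0])
}.

Section canonical_map.
Context {X : ptopologicalType} {R : realType}.

Lemma Cc_measurable (f : Cc X R) :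
  measurable_fun [set: borel X] (f : borel X -> R).
Proof.
apply: (measurability (@RGenOInfty.G R)) => [|_ [_ [r ->] <-]].
  exact: RGenOInfty.measurableE.
rewrite setTI; apply: sub_sigma_algebra.
apply: open_comp => [x _|]; first exact: Cc_continuous.
exact: interval_open.
Qed.

Definition Cc_mfun (f : Cc X R) : {mfun borel X >-> R} :=
  mfun_Sub (mem_set (Cc_measurable f)).

Definition Cc_to_L0 (mu : {measure set (borel X) -> \bar R}) (f : Cc X R) :
    L0 mu :=
  L0_class mu (Cc_mfun f).

End canonical_map.

(* Main.v *)
(** It suffices that decreasing sequences [u] of positive elements have steps
    [u n - u n.+1] of arbitrarily small norm: then decreasing nets are Cauchy,
    and a norm limit is a lower bound. If all steps have norm at least [e], the
    sums of the steps indexed by Dedekind cuts of the rationals form an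
    [e]-separated family, indexed by the reals, in the order interval from [0]
    to [u 0], so it is enough that order intervals of [E] are norm separable.
    An order interval from [0] to [u] lies close to the one from [0] to [|g|]
    for some [g] in [Cc(X)], and by density its elements are close to continuous
    functions clamped between [0] and [|g|]. On the metrisable compact support
    of [g] such functions are uniformly separable, and a uniform error [eta^2]
    of functions bounded by [|g|] is at most [eta * sqrt |g|], which has small
    norm in [E]; so no Urysohn function is needed. *)
Require Import Defs.
From HB Require Import structures.
From mathcomp Require Import all_boot all_order all_algebra.
From mathcomp Require Import all_classical all_reals all_analysis.
From mathcomp Require Import measurable_realfun hoelder.
From mathcomp Require Import lra.
Import Order.TTheory GRing.Theory Num.Theory.
Import numFieldNormedType.Exports.
Local Open Scope classical_set_scope.
Local Open Scope ring_scope.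

Set Implicit Arguments.
Unset Strict Implicit.

(** * Uncountability of the reals *)

Lemma uncountable_reals (R : realType) (c : R -> nat) : ~ injective c.
Proof.
move=> cI; have : countable [set: R].
  by apply/countable_injP; exists c => x y _ _; exact: cI.
(* Countable sets are Lebesgue null, but the unit interval has measure 1. *)
move=> /(sub_countable (subset_card_le (@subsetT _ `[0%R, 1%R]))).
move=> /countable_lebesgue_measure0.
rewrite lebesgue_measure_itv/= lte_fin ltr01 oppr0 adde0.
by move=> /eqP; rewrite eqe oner_eq0.
Qed.

(** * Compact metric spaces and uniform separability *)

Lemma compact_set_type (X : topologicalType) (K : set X) :
  compact K -> compact [set: set_type K].
Proof.
move=> /compact_near_coveringP/near_covering_withinP cK.
apply/compact_near_coveringP => J F P FF PF.
(* Taking membership as an argument extends [P] to all of [X], where the covering property of [K]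
   applies. *)
pose P' i x := forall Kx : x \in K, P i (exist _ x Kx).
have : \forall i \near F, K `<=` P' i; last first.
  by apply: filterS => i KP [x Kx] _; apply: KP; exact/set_mem.
apply: cK => x Kx.
have [[A B] /= [xA FB] ABP] := PF (exist _ x (mem_set Kx)) I.
move: xA; rewrite nbhsE => -[_ [[V oV <-] Vx] VA].
exists (V, B); first by split => //; apply: open_nbhs_nbhs.
move=> [y i] /= [Vy Bi] Ky h.
by apply: (ABP (_, _)); split => //=; exact: VA.
Qed.

Section compact_metric.
Variables (R : realType) (Y : topologicalType) (rho : Y -> Y -> R).
Hypotheses (rho_tri : forall x y z, rho x z <= rho x y + rho y z)
  (rho_nbhs : forall (x : Y) (U : set Y), nbhs x U <->
     exists2 e : R, 0 < e & [set y | rho x y < e] `<=` U)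
  (cptY : compact [set: Y]).

Lemma compact_finite_net (e : R) : 0 < e ->
  exists s : seq Y, forall y, exists2 c, c \in s & rho c y < e.
Proof.
move=> e0; pose P (s : seq Y) y := exists2 c, c \in s & rho c y < e.
(* The filter of finite lists that grow under inclusion; a near covering along it glues the
   one-point nets. *)
pose F (S : set (seq Y)) :=
  exists s : seq Y, forall t : seq Y, {subset s <= t} -> S t.
have FF : Filter F.
  split; first by exists [::].
  - move=> S T [s sS] [t tT]; exists (s ++ t) => u stu; split.
      by apply: sS => c cs; apply: stu; rewrite mem_cat cs.
    by apply: tT => c ct; apply: stu; rewrite mem_cat ct orbT.
  - by move=> S T ST [s sS]; exists s => t /sS /ST.
suff [s /(_ s (fun c cs => cs)) sP] : F [set s | [set: Y] `<=` P s].
  by exists s => y; exact: sP.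
apply: ((compact_near_coveringP [set: Y]).1 cptY _ F) => x _.
exists ([set y | rho x y < e], [set s | x \in s]).
  split => /=; first by apply/rho_nbhs; exists e.
  by exists [:: x] => t; apply; rewrite mem_head.
by move=> [y s] /= [xy xs]; exists x.
Qed.

Lemma compact_uniformly_continuous (f : Y -> R) (e : R) :
  continuous f -> 0 < e ->
  exists n : nat, forall x y, rho x y < n.+1%:R^-1 -> `|f x - f y| < e.
Proof.
move=> cf e0; pose P (n : nat) x :=
  forall y, rho x y < n.+1%:R^-1 -> `|f x - f y| < e.
suff /filter_ex[n Pn] : \forall n \near \oo, [set: Y] `<=` P n.
  by exists n => x y; exact: Pn.
apply: (compact_near_coveringP [set: Y]).1 => // x _.
have e20 : 0 < e / 2 by rewrite divr_gt0.
have /rho_nbhs[r r0 xr] : nbhs x [set y | `|f x - f y| < e / 2].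
  by have /cvgrPdist_lt := cf x; apply.
have r20 : 0 < r / 2 by rewrite divr_gt0.
exists ([set x' | rho x x' < r / 2], [set n | n.+1%:R^-1 < r / 2]).
  split => /=; first by apply/rho_nbhs; exists (r / 2).
  exact: near_infty_natSinv_lt (PosNum r20).
move=> [x' n] /= [xx' nr] y x'y.
have fx' : `|f x - f x'| < e / 2.
  apply: xr => /=; apply: lt_trans xx' _.
  by rewrite ltr_pdivrMr// ltr_pMr// ltr1n.
have fy : `|f x - f y| < e / 2.
  apply: xr => /=; apply: (le_lt_trans (rho_tri x x' y)).
  by rewrite [ltRHS](splitr r) ltrD// (lt_trans x'y).
by move: fx' fy; rewrite !ltr_norml; lra.
Qed.

End compact_metric.

(* The code of [f] records a mesh [1/n] on which [f] oscillates little, and the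
   rounded values of [f] on a finite [1/n]-net fixed in advance. *)
Lemma continuous_countable_code (R : realType) (X : topologicalType)
    (K : set X) (e : R) :
  compact K -> metrizable R (set_type K) -> 0 < e ->
  exists code : (X -> R) -> nat, forall f g : X -> R,
    continuous f -> continuous g -> code f = code g ->
    forall x, K x -> `|f x - g x| < e.
Proof.
move=> cK [rho [_ _ _ rho_tri rho_nbhs]] e0.
have cY := compact_set_type cK.
have e30 : 0 < e / 3 by rewrite divr_gt0.
have net n : {s : seq (set_type K) |
    forall y, exists2 c, c \in s & rho c y < n.+1%:R^-1}.
  by apply: cid; apply: (compact_finite_net rho_nbhs cY); rewrite invr_gt0.
have mesh (f : X -> R) : {n : nat | continuous f ->
    forall x y : set_type K, rho x y < n.+1%:R^-1 ->
      `|f (val x) - f (val y)| < e / 3}.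
  (* The code is total, so discontinuous functions get the junk mesh 0. *)
  apply/cid; have [cf|] := pselect (continuous f); last by exists 0%N.
  have cfv : continuous (f \o val : set_type K -> R).
    by move=> x; apply: continuous_comp; [exact: initial_continuous|exact: cf].
  have [n fn] := compact_uniformly_continuous rho_tri rho_nbhs cY cfv e30.
  by exists n.
pose code f := (sval (mesh f),
  [seq Num.floor (f (val c) / (e / 3)) | c <- sval (net (sval (mesh f)))]).
exists (pickle \o code) => f g cf cg /(pcan_inj pickleK)[].
rewrite /code; case: (mesh f) => n /= /(_ cf) fn.
case: (mesh g) => m /= /(_ cg) gm.
(* Equal meshes mean the same net, so the two lists of floors are compared point by point. *)
move=> nm; subst m => /eq_in_map fg x Kx.
have [c cs cx] := (svalP (net n)) (exist _ x (mem_set Kx)).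
have {}fn := fn _ _ cx; have {}gm := gm _ _ cx.
have {}fg := fg _ cs.
rewrite /= in fn gm.
have fgc : `|f (val c) - g (val c)| < e / 3.
  rewrite -(divfK (lt0r_neq0 e30) (f (val c))).
  rewrite -(divfK (lt0r_neq0 e30) (g (val c))).
  rewrite -mulrBl normrM (gtr0_norm e30) gtr_pMl//.
  set a := _ / _ in fg *; set b := g _ / _ in fg *.
  have := floor_le_tmp a; have := floor_le_tmp b.
  have := floorD1_gt a; have := floorD1_gt b; rewrite fg !intrD1.
  by move=> h1 h2 h3 h4; rewrite ltr_norml; lra.
by move: fn gm fgc; rewrite !ltr_norml; lra.
Qed.

(** * Almost everywhere calculus in L^0 and in Banach function spaces *)

Section L0_theory.
Context {d : measure_display} {T : measurableType d} {R : realType}.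
Context {mu : {measure set T -> \bar R}}.
Implicit Types x y : L0 mu.

Lemma L0_fun0 : \forall t \ae mu, L0_fun (0 : L0 mu) t = 0.
Proof. exact: L0_zeroE. Qed.

Lemma L0_funD x y :
  \forall t \ae mu, L0_fun (x + y) t = L0_fun x t + L0_fun y t.
Proof. exact: L0_addE. Qed.

Lemma L0_funB x y :
  \forall t \ae mu, L0_fun (x - y) t = L0_fun x t - L0_fun y t.
Proof.
have h1 := L0_addE x (- y); have h2 := L0_oppE y.
by near=> t; rewrite [LHS](near h1 t)// (near h2 t).
Unshelve. all: end_near. Qed.

Lemma L0_funZ (a : R) x : \forall t \ae mu, L0_fun (a *: x) t = a * L0_fun x t.
Proof. exact: L0_scaleE. Qed.

Lemma L0_fun_abs x : \forall t \ae mu, L0_fun (L0_abs x) t = `|L0_fun x t|.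
Proof.
have h1 := L0_joinE x (- x); have h2 := L0_oppE x.
near=> t; rewrite [LHS](near h1 t)// (near h2 t)//.
exact: maxrN.
Unshelve. all: end_near. Qed.

Lemma L0_leP x y : x <= y <-> \forall t \ae mu, L0_fun x t <= L0_fun y t.
Proof. by split=> [/asboolP|?]; last exact/asboolP. Qed.

Lemma L0_ge0P x : 0 <= x <-> \forall t \ae mu, 0 <= L0_fun x t.
Proof.
have h := L0_fun0; rewrite L0_leP; split => x0; near=> t.
  by rewrite -[leLHS](near h t)//; near: t.
by rewrite [leLHS](near h t)//; near: t.
Unshelve. all: end_near. Qed.

Lemma L0_le_absP x y : L0_abs x <= L0_abs y <->
  \forall t \ae mu, `|L0_fun x t| <= `|L0_fun y t|.
Proof.
have h1 := L0_fun_abs x; have h2 := L0_fun_abs y.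
rewrite L0_leP; split => xy; near=> t.
  by rewrite -[leLHS](near h1 t)// -[leRHS](near h2 t)//; near: t.
by rewrite [leLHS](near h1 t)// [leRHS](near h2 t)//; near: t.
Unshelve. all: end_near. Qed.

Variable E : banachFunctionSpace mu.
Local Notation N := (bfs_norm E).

Lemma bfsD x y : bfs_set E x -> bfs_set E y -> bfs_set E (x + y).
Proof. by case: (bfs_ideal E) => _ /(_ 1 x y) + _; rewrite scale1r. Qed.

Lemma bfsZ (a : R) x : bfs_set E x -> bfs_set E (a *: x).
Proof.
by case: (bfs_ideal E) => E0 /(_ a x 0) + _ Ex; rewrite addr0; exact.
Qed.

Lemma bfsB x y : bfs_set E x -> bfs_set E y -> bfs_set E (x - y).
Proof. by move=> Ex Ey; rewrite -scaleN1r; exact/bfsD/bfsZ. Qed.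

Lemma bfs_dominated x y : bfs_set E y ->
  (\forall t \ae mu, `|L0_fun x t| <= `|L0_fun y t|) ->
  bfs_set E x /\ N x <= N y.
Proof.
move=> Ey /L0_le_absP xy; have Ex : bfs_set E x.
  by case: (bfs_ideal E) => _ _ /(_ y x Ey xy).
by split => //; case: (bfs_lattice_norm E) => _ _ _ _; exact.
Qed.

Lemma bfs_norm_ge0 x : bfs_set E x -> 0 <= N x.
Proof. by case: (bfs_lattice_norm E) => + _ _ _ _; exact. Qed.

Lemma bfs_normZ (a : R) x : bfs_set E x -> N (a *: x) = `|a| * N x.
Proof. by case: (bfs_lattice_norm E) => _ _ + _ _; exact. Qed.

Lemma bfs_normD x y : bfs_set E x -> bfs_set E y -> N (x + y) <= N x + N y.
Proof. by case: (bfs_lattice_norm E) => _ _ _ + _; exact. Qed.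

Lemma bfs_abs x : bfs_set E x -> bfs_set E (L0_abs x) /\ N (L0_abs x) <= N x.
Proof.
move=> Ex; apply: bfs_dominated => //; have h := L0_fun_abs x.
by near=> t; rewrite (near h t)// normr_id.
Unshelve. all: end_near. Qed.

Lemma bfs_ge0_le x y : bfs_set E y -> 0 <= x -> x <= y ->
  bfs_set E x /\ N x <= N y.
Proof.
move=> Ey /L0_ge0P x0 /L0_leP xy; apply: bfs_dominated => //; near=> t.
rewrite !ger0_norm//; near: t => //.
by apply: filterS2 x0 xy => t; exact: le_trans.
Unshelve. all: end_near. Qed.

Lemma bfs_dominatedD x a b : bfs_set E a -> bfs_set E b ->
  (\forall t \ae mu, `|L0_fun x t| <= `|L0_fun a t| + `|L0_fun b t|) ->
  bfs_set E x /\ N x <= N a + N b.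
Proof.
move=> Ea Eb xab; have [Ea' Na] := bfs_abs Ea; have [Eb' Nb] := bfs_abs Eb.
have [|Ex Nx] := @bfs_dominated x _ (bfsD Ea' Eb').
  have h := L0_funD (L0_abs a) (L0_abs b).
  have ha := L0_fun_abs a; have hb := L0_fun_abs b.
  near=> t; rewrite [X in _ <= `|X|](near h t)// (near ha t)// (near hb t)//.
  by rewrite (ger0_norm (addr_ge0 _ _))//; near: t.
split => //; apply: le_trans Nx _; apply: le_trans (bfs_normD Ea' Eb') _.
exact: lerD.
Unshelve. all: end_near. Qed.

End L0_theory.

(** * Coding order intervals by continuous functions *)

Section continuous_functions.
Context {X : ptopologicalType} {R : realType}.

Lemma Cc_to_L0E (mu : {measure set (borel X) -> \bar R}) (f : Cc X R) :
  \forall t \ae mu, L0_fun (Cc_to_L0 mu f) t = f t.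
Proof. exact: L0_classK. Qed.

(** Supplies the fixed element of [E] that absorbs uniform errors; the root has the zero set of [g],
    hence its support. *)
Lemma sqrt_abs_Cc (g : Cc X R) :
  exists w : Cc X R, w =1 fun t => Num.sqrt `|g t|.
Proof.
have cw : continuous (fun t => Num.sqrt `|g t|).
  move=> t; apply: (continuous_comp (f := fun t => `|g t|)).
    apply: (continuous_comp (f := g)); first exact: Cc_continuous.
    exact: norm_continuous.
  exact: sqrt_continuous.
have sw : compact (closure [set t | Num.sqrt `|g t| != 0]).
  rewrite (_ : [set t | _] = [set t | g t != 0]).
    exact: Cc_compact_support.
  by apply/seteqP; split=> t /=; rewrite sqrtr_eq0 -ltNge normr_gt0.
by exists (MkCc cw sw).
Qed.

End continuous_functions.

(* Clamping [a] and [b] to [0, |g|] leaves a difference of at most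
   [min(|g|, eta^2)], which is [<= eta * sqrt |g|]. *)
Lemma clamp_dist (R : realType) (x y u a b g eta : R) :
  0 <= x <= u -> 0 <= y <= u -> 0 <= eta -> g = 0 \/ `|a - b| < eta ^+ 2 ->
  `|x - y| <= (`|x - a| + `|y - b|) + (`|u - g| + `|u - g|)
              + eta * Num.sqrt `|g|.
Proof.
move=> /andP[x0 xu] /andP[y0 yu] eta0 ab.
pose c z := Num.min (Num.max z 0) `|g|.
have h0 := normr_ge0 g.
have cP v : [\/ v <= 0 /\ c v = 0, 0 <= v <= `|g| /\ c v = v |
               0 <= v /\ `|g| <= v /\ c v = `|g| ].
  rewrite /c; case: (leP v 0) => v0.
    by constructor 1; rewrite min_l.
  by case: (leP v `|g|) => gv; [constructor 2|constructor 3]; rewrite ?ltW.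
have ug : `|u - `|g| | <= `|u - g|.
  by apply: le_trans (ler_dist_dist u g); rewrite (ger0_norm (le_trans x0 xu)).
(* For [z] in [0, u], clamping an approximant to [0, |g|] instead of [0, u] costs at most
   [|u - g|]. *)
have clampP z v : 0 <= z -> z <= u -> `|z - c v| <= `|z - v| + `|u - g|.
  move=> z0 zu; apply: le_trans (lerD (lexx _) ug).
  by case: (cP v) => [[? ->]|[/andP[? ?] ->]|[? [? ->]]];
    case: (ger0P (u - `|g|)) => ?; case: (ger0P (z - v)) => ?;
    rewrite ?ler_norml; lra.
have cab : `|c a - c b| <= eta * Num.sqrt `|g|.
  have s0 := sqrtr_ge0 `|g|; have := sqr_sqrtr (normr_ge0 g).
  move: s0; set s := Num.sqrt _ => s0 gs.
  have cg : `|c a - c b| <= `|g|.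
    by case: (cP a) => [[? ->]|[/andP[? ?] ->]|[? [? ->]]];
      case: (cP b) => [[? ->]|[/andP[? ?] ->]|[? [? ->]]];
      rewrite ?ler_norml; lra.
  (* Where [g] vanishes both clamped values are 0. *)
  case: ab => [g0|ab]; first by rewrite (le_trans cg)// g0 normr0 mulr_ge0.
  have cd : `|c a - c b| <= `|a - b|.
    by case: (cP a) => [[? ->]|[/andP[? ?] ->]|[? [? ->]]];
      case: (cP b) => [[? ->]|[/andP[? ?] ->]|[? [? ->]]];
      case: (ger0P (a - b)) => ?; rewrite ?ler_norml; lra.
  (* With |g| = s^2: if s <= eta, then s^2 <= eta * s; otherwise eta^2 <= eta * s. *)
  case: (leP s eta) => se.
    by rewrite (le_trans cg)// -gs expr2 ler_wpM2r.
  by rewrite (le_trans cd)// (le_trans (ltW ab))// expr2 ler_wpM2l// ltW.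
have := clampP _ a x0 xu; have := clampP _ b y0 yu; move: cab.
have : `|x - y| <= `|x - c a| + `|c a - c b| + `|y - c b|.
  rewrite (distrC y); apply: le_trans (ler_distD (c b) _ _) _.
  by rewrite lerD2r ler_distD.
lra.
Qed.

(** The code of [x] is that of a chosen continuous approximant, read on the support of a [g] with
    [j g] close to [u]. *)
Lemma interval_countable_code (R : realType) (X : ptopologicalType)
    (mu : {measure set (borel X) -> \bar R}) (E : banachFunctionSpace mu)
    (u : L0 mu) (e : R) :
  (forall K : set X, compact K -> metrizable R (set_type K)) ->
  range (@Cc_to_L0 X R mu) `<=` bfs_set E ->
  is_dense_in (bfs_set E) (bfs_norm E) (range (@Cc_to_L0 X R mu)) ->
  bfs_set E u -> 0 < e ->
  exists code : L0 mu -> nat, forall x y,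
    0 <= x -> x <= u -> 0 <= y -> y <= u -> code x = code y -> bfs_norm E (x - y) < e.
Proof.
move=> metr jE jdense Eu e0; set j := @Cc_to_L0 X R mu in jE jdense *.
have Ej f : bfs_set E (j f) by apply: jE; exists f.
(* The final estimate sums five errors below [e / 8]: one each for [x], [y] and [eta *: j w], and
   two for [u]. *)
have e80 : 0 < e / 8 by rewrite divr_gt0.
have approx x : {f : Cc X R | bfs_set E x -> bfs_norm E (x - j f) < e / 8}.
  apply/cid; have [Ex|nEx] := pselect (bfs_set E x).
    by have [_ [f _ <-] xf] := jdense x Ex _ e80; exists f.
  by have [_ [f _ _] _] := jdense u Eu _ e80; exists f.
pose g := sval (approx u); have ug := svalP (approx u) Eu.
have [w wE] := sqrt_abs_Cc g.
have Nw0 := bfs_norm_ge0 (Ej w).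
(* The added 1 keeps the denominator positive when [j w] has norm 0. *)
pose eta := e / 8 / (bfs_norm E (j w) + 1).
have eta0 : 0 < eta by rewrite divr_gt0// ltr_wpDl.
have etaw : eta * bfs_norm E (j w) < e / 8.
  by rewrite /eta mulrAC ltr_pdivrMr ?ltr_wpDl// ltr_pM2l// ltrDl.
have cg := @Cc_compact_support _ _ g.
have [code codeP] :=
  continuous_countable_code cg (metr _ cg) (exprn_gt0 2 eta0).
exists (fun x => code (sval (approx x))) => x y x0 xu y0 yu xy.
have [Ex _] := bfs_ge0_le Eu x0 xu; have [Ey _] := bfs_ge0_le Eu y0 yu.
have xa := svalP (approx x) Ex; have yb := svalP (approx y) Ey.
move: xy xa yb; rewrite -/g in ug.
set a := sval (approx x); set b := sval (approx y) => ab xa yb.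
have {}ab t : g t = 0 \/ `|a t - b t| < eta ^+ 2.
  have [->|gt0] := eqVneq (g t) 0; [by left|right].
  by apply: (codeP _ _ (@Cc_continuous _ _ a) (@Cc_continuous _ _ b) ab);
    exact: subset_closure.
have [Exa Nxa] := bfs_abs (bfsB Ex (Ej a)).
have [Eyb Nyb] := bfs_abs (bfsB Ey (Ej b)).
have [Eug Nug] := bfs_abs (bfsB Eu (Ej g)).
have E1 := bfsD Exa Eyb; have E2 := bfsD Eug Eug; have E3 := bfsZ eta (Ej w).
have E12 := bfsD E1 E2.
have [|_ Nxy] := @bfs_dominated _ _ _ _ E (x - y) _ (bfsD E12 E3).
  have k1 := L0_funD (L0_abs (x - j a) + L0_abs (y - j b)
    + (L0_abs (u - j g) + L0_abs (u - j g))) (eta *: j w).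
  have k2 := L0_funD (L0_abs (x - j a) + L0_abs (y - j b))
    (L0_abs (u - j g) + L0_abs (u - j g)).
  have k3 := L0_funD (L0_abs (x - j a)) (L0_abs (y - j b)).
  have k4 := L0_funD (L0_abs (u - j g)) (L0_abs (u - j g)).
  have k5 := L0_funZ eta (j w); have k6 := L0_funB x y.
  have a1 := L0_fun_abs (x - j a); have a2 := L0_fun_abs (y - j b).
  have a3 := L0_fun_abs (u - j g).
  have s1 := L0_funB x (j a); have s2 := L0_funB y (j b).
  have s3 := L0_funB u (j g).
  have ja := Cc_to_L0E mu a; have jb := Cc_to_L0E mu b.
  have jg := Cc_to_L0E mu g; have jw := Cc_to_L0E mu w.
  move/L0_ge0P: x0 => x0; move/L0_ge0P: y0 => y0.
  move/L0_leP: xu => xu; move/L0_leP: yu => yu.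
  near=> t.
  rewrite (near k6 t)// (near k1 t)// (near k2 t)// (near k3 t)// (near k4 t)//.
  rewrite (near k5 t)// (near a1 t)// (near a2 t)// (near a3 t)//.
  rewrite (near s1 t)// (near s2 t)// (near s3 t)//.
  rewrite (near ja t)// (near jb t)// (near jg t)// (near jw t)// wE.
  apply: (le_trans _ (ler_norm _)); apply: clamp_dist => //; last exact: ltW.
    by apply/andP; split; near: t.
  by apply/andP; split; near: t.
have := bfs_normD E12 E3; have := bfs_normD E1 E2.
have := bfs_normD Exa Eyb; have := bfs_normD Eug Eug.
rewrite bfs_normZ// (gtr0_norm eta0).
move: etaw; set p := eta * _ => ? ? ? ? ?; lra.
Unshelve. all: end_near. Qed.

(** * Uncountable chains from decreasing sequences *)

Definition rat_enum (i : nat) : rat := odflt 0 (unpickle i).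

(* The [x r], which are the sums of the [u i - u i.+1] with [rat_enum i < r],
   form an uncountable chain. *)
Lemma real_chain_of_decreasing (d : measure_display) (T : measurableType d)
    (R : realType) (mu : {measure set T -> \bar R}) (u : nat -> L0 mu) :
  (forall n, 0 <= u n) -> (forall n, u n.+1 <= u n) ->
  exists x : R -> L0 mu, (forall r, 0 <= x r /\ x r <= u 0%N) /\
    (forall r s, r < s -> exists n, u n - u n.+1 <= x s - x r).
Proof.
move=> u0 uS; pose U n := L0_fun (u n).
(* The sequence decreases only almost everywhere; truncation makes the series nonnegative at every
   point. *)
pose v n t := Num.max (U n t - U n.+1 t) 0.
have v0 n t : (0 <= (v n t)%:E)%E by rewrite lee_fin le_max lexx orbT.
pose P (r : R) : pred nat := fun i => ratr (rat_enum i) < r.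
pose S (r : R) t : \bar R := (\sum_(0 <= i <oo | P r i) (v i t)%:E)%E.
have S0 r t : (0 <= S r t)%E by apply: nneseries_ge0.
(* [fine] gives a real-valued representative; it changes the sum only on a null set, by [S_fin]
   below. *)
have mS r : measurable_fun setT (fine \o S r).
  apply: (measurableT_comp (fine_measurable measurableT)).
  apply: ge0_emeasurable_sum => // k _.
  apply/measurable_EFinP; apply: measurable_maxr => //.
  by apply: measurable_funB; exact: measurable_funP.
pose x r := L0_class mu (mfun_Sub (mem_set (mS r))).
have xE r : \forall t \ae mu, L0_fun (x r) t = fine (S r t) by exact: L0_classK.
have good : \forall t \ae mu, forall n, 0 <= U n t /\ U n.+1 t <= U n t.
  apply: ae_foralln => n; move: (u0 n) (uS n) => /L0_ge0P a /L0_leP b.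
  by apply: filterS2 a b.
have S_le r t : (forall n, 0 <= U n t /\ U n.+1 t <= U n t) ->
    (S r t <= (U 0%N t)%:E)%E.
  move=> gt; apply: lime_le; first by apply: is_cvg_nneseries.
  apply: nearW => n; rewrite big_mkcond/=.
  (* Filling in the omitted steps gives a telescoping sum, equal to [U 0 t - U n t]. *)
  apply: (@le_trans _ _ (\sum_(0 <= i < n) (U i t - U i.+1 t)%:E)%E).
    apply: lee_sum => i _; have [Ui UiS] := gt i.
    rewrite /v max_l ?subr_ge0//; case: ifP => // _.
    by rewrite lee_fin subr_ge0.
  rewrite sumEFin lee_fin; under eq_bigr do rewrite -opprB.
  by rewrite sumrN telescope_sumr// opprB gerBl; case: (gt n).
have S_fin r t : (forall n, 0 <= U n t /\ U n.+1 t <= U n t) ->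
    S r t \is a fin_num.
  by move=> gt; rewrite ge0_fin_numE// (le_lt_trans (S_le r t gt)) ?ltry.
exists x; split=> [r|r s rs].
  have xr := xE r; split; [apply/L0_ge0P|apply/L0_leP]; near=> t.
    by rewrite (near xr t)// fine_ge0.
  have gt : forall n, 0 <= U n t /\ U n.+1 t <= U n t by near: t.
  by rewrite (near xr t)// -lee_fin fineK ?S_fin ?S_le.
(* The index of a rational between [r] and [s] is summed in [S s] but not in [S r], so the
   difference is at least that step. *)
have [q] := rat_in_itvoo rs; rewrite in_itv/= => /andP[rq qs].
pose n := pickle q; have nq : rat_enum n = q by rewrite /rat_enum pickleK.
exists n; apply/L0_leP.
have h1 := L0_funB (u n) (u n.+1); have h2 := L0_funB (x s) (x r).
have xr := xE r; have xs := xE s; near=> t.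
have gt : forall n, 0 <= U n t /\ U n.+1 t <= U n t by near: t.
rewrite (near h1 t)// (near h2 t)// (near xr t)// (near xs t)//.
rewrite lerBrDr -lee_fin EFinD !fineK ?S_fin//.
rewrite {2}/S (nneseriesD1 (n := n)) //; last by rewrite /P nq.
apply: leeD; first by rewrite lee_fin le_max lexx.
apply: subset_lee_nneseries => // i; rewrite /P => ri.
rewrite (lt_trans ri (lt_trans rq qs)); apply/eqP => i_n.
by move: ri; rewrite i_n nq ltNge ltW.
Unshelve. all: end_near. Qed.

(** * From coded order intervals to order continuity *)

Section countably_coded_intervals.
Context {d : measure_display} {T : measurableType d} {R : realType}.
Context {mu : {measure set T -> \bar R}}.
Variable E : banachFunctionSpace mu.
Local Notation N := (bfs_norm E).

(* Order intervals are norm separable, stated as a countable partition of the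
   interval into pieces of small diameter. *)
Hypothesis coded : forall (u : L0 mu) (e : R), bfs_set E u -> 0 < e ->
  exists code : L0 mu -> nat, forall x y,
    0 <= x -> x <= u -> 0 <= y -> y <= u -> code x = code y -> N (x - y) < e.

(** Otherwise distinct members of the chain over the reals are at distance at least [e], and their
    codes inject the reals into [nat]. *)
Lemma decreasing_small_step (u : nat -> L0 mu) (e : R) :
  bfs_set E (u 0%N) -> (forall n, 0 <= u n) -> (forall n, u n.+1 <= u n) ->
  0 < e -> exists n, N (u n - u n.+1) < e.
Proof.
move=> Eu u0 uS e0; apply: contrapT => /forallNP big.
have [code codeP] := coded Eu e0.
have [x [xP xlt]] := real_chain_of_decreasing u0 uS.
have Ex r : bfs_set E (x r).
  by have [x0 xu] := xP r; case: (bfs_ge0_le Eu x0 xu).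
have lt_neq r s : r < s -> code (x r) <> code (x s).
  move=> rs crs; have [n un] := xlt _ _ rs.
  have [xr0 xru] := xP r; have [xs0 xsu] := xP s.
  apply: (big n); apply: le_lt_trans (codeP _ _ xs0 xsu xr0 xru (esym crs)).
  have un0 : 0 <= u n - u n.+1 by rewrite -(subrr (u n.+1)); exact: L0_leD2r.
  by case: (bfs_ge0_le (bfsB (Ex s) (Ex r)) un0 un).
apply: (@uncountable_reals R (code \o x)) => r s /= rs.
by case: (ltgtP r s) => // /lt_neq; rewrite rs.
Qed.

(** Otherwise each index has a later one at distance at least [e]; iterating this choice gives a
    decreasing sequence without small steps. *)
Lemma decreasing_net_cauchy (I : Type) (r : I -> I -> Prop) (x : I -> L0 mu)
    (e : R) :
  directed_preorder r -> net_decreases_to0 E r x -> 0 < e ->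
  exists i, forall j, r i j -> N (x i - x j) < e.
Proof.
move=> [[i0 _] _ _ _] [Ex xdec x0 _] e0; apply: contrapT => /forallNP big.
have next i : {j | r i j & e <= N (x i - x j)}.
  apply/cid2; apply: contrapT => nj; apply: (big i) => j rij.
  by rewrite ltNge; apply/negP => le; apply: nj; exists j.
pose s n := iter n (fun i => s2val (next i)) i0.
have [||||n] := @decreasing_small_step (x \o s) e => //.
- exact: Ex.
- by move=> n /=; apply: x0.
- by move=> n; apply: xdec; exact: (s2valP (next (s n))).
by rewrite ltNge => /negP; apply; exact: (s2valP' (next (s n))).
Qed.

Lemma order_continuous_of_coded : order_continuous E.
Proof.
move=> I r x dir dec e e0.
case: (dir) (dec) => _ _ rtrans rdir [Ex xdec x0 xinf].
have stage n : {i | forall j, r i j -> N (x i - x j) < n.+1%:R^-1}.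
  by apply/cid/(decreasing_net_cauchy dir dec); rewrite invr_gt0.
pose y n := x (sval (stage n)).
have yx n j : r (sval (stage n)) j -> N (y n - x j) < n.+1%:R^-1.
  exact: (svalP (stage n)).
have Ey n : bfs_set E (y n) by exact: Ex.
have NB a b c : bfs_set E a -> bfs_set E b -> bfs_set E c ->
    N (a - b) <= N (a - c) + N (b - c).
  move=> Ea Eb Ec.
  have [|//] := @bfs_dominatedD _ _ _ _ E (a - b) _ _ (bfsB Ea Ec) (bfsB Eb Ec).
  have h1 := L0_funB a b; have h2 := L0_funB a c; have h3 := L0_funB b c.
  near=> t; rewrite (near h1 t)// (near h2 t)// (near h3 t)//.
  by rewrite (distrC (L0_fun b t)) ler_distD.
have [|z Ez yz] := bfs_complete Ey.
  move=> a a0; have a20 : 0 < a / 2 by rewrite divr_gt0.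
  have [m _ mP] := near_infty_natSinv_lt (PosNum a20); exists m => p q mp mq.
  (* The chosen stages need not increase, so [y p] and [y q] are compared through a common later
     [x k]. *)
  have [k [pk qk]] := rdir (sval (stage p)) (sval (stage q)).
  apply: le_lt_trans (NB _ _ (x k) (Ey p) (Ey q) (Ex k)) _; rewrite (splitr a).
  by apply: ltrD; [apply: lt_trans (yx _ _ pk) _|apply: lt_trans (yx _ _ qk) _];
    exact: mP.
have close a : 0 < a -> exists n, n.+1%:R^-1 < a /\ N (y n - z) < a.
  move=> a0; have := near_infty_natSinv_lt (PosNum a0).
  move/cvgrPdist_lt : yz => /(_ _ a0) yz.
  move=> /(filterI yz)/filter_ex[n [/= ]].
  by rewrite sub0r normrN => /(le_lt_trans (ler_norm _)) h1 h2; exists n.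
have le_split n k : r (sval (stage n)) k -> forall w, bfs_set E w ->
    (\forall t \ae mu, `|L0_fun w t| <=
      `|L0_fun (y n - x k) t| + `|L0_fun (y n - z) t|) ->
    N w <= n.+1%:R^-1 + N (y n - z).
  move=> nk w Ew ww.
  have [_ Nw] := bfs_dominatedD (bfsB (Ey n) (Ex k)) (bfsB (Ey n) Ez) ww.
  by apply: le_trans Nw _; rewrite lerD2r ltW// yx.
have z_le0 : z <= 0.
  apply: xinf => // i.
  (* The positive part of [z - x i] has norm 0: for [k] past [i] and stage [n],
     [z - x i <= (y n - x k) - (y n - z)]. *)
  pose w := Order.join (z - x i) 0.
  have wE : \forall t \ae mu,
      L0_fun w t = Num.max (L0_fun z t - L0_fun (x i) t) 0.
    have h1 := L0_joinE (z - x i) 0; have h2 := L0_funB z (x i).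
    have h3 := @L0_fun0 _ _ _ mu.
    by near=> t; rewrite [LHS](near h1 t)// (near h2 t)// (near h3 t).
  have Ew : bfs_set E w.
    apply: (bfs_dominated (bfsB Ez (Ex i)) _).1; have h := L0_funB z (x i).
    near=> t; rewrite (near wE t)// (near h t)//.
    by case: (leP (L0_fun z t - L0_fun (x i) t) 0); rewrite ?normr0.
  have Nw : N w = 0.
    apply/eqP; rewrite eq_le bfs_norm_ge0// andbT; apply/ler_addgt0Pl => a a0.
    have a20 : 0 < a / 2 by rewrite divr_gt0.
    have [n [n1 n2]] := close _ a20.
    have [k [nk ik]] := rdir (sval (stage n)) i.
    rewrite addr0 (splitr a).
    apply: le_trans (le_split n k nk w Ew _) _; last first.
      by rewrite ltW// ltrD.
    have h1 := L0_funB (y n) (x k); have h2 := L0_funB (y n) z.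
    move/L0_leP: (xdec _ _ ik) => xki.
    near=> t; rewrite (near wE t)// (near h1 t)// (near h2 t)//.
    have : L0_fun (x k) t <= L0_fun (x i) t by near: t.
    have := ler_norm (L0_fun (y n) t - L0_fun (x k) t).
    have := ler_norm (- (L0_fun (y n) t - L0_fun z t)); rewrite normrN.
    have := normr_ge0 (L0_fun (y n) t - L0_fun (x k) t).
    have := normr_ge0 (L0_fun (y n) t - L0_fun z t).
    set p := `|_|; set q := `|_|.
    rewrite ger0_norm ?le_max ?lexx ?orbT// ge_max => *.
    by apply/andP; split; lra.
  have w0 : w = 0 by case: (bfs_lattice_norm E) => _ /(_ _ Ew Nw).
  have /(L0_leD2r (x i)) : z - x i <= 0 by rewrite -w0 leUl.
  by rewrite subrK add0r.
have [n [n1 n2]] := close (e / 2) ltac:(by rewrite divr_gt0).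
exists (sval (stage n)) => i ni.
rewrite (splitr e).
(* Since [z <= 0], 0 <= x i <= x i - z = (y n - z) - (y n - x i). *)
apply: le_lt_trans (le_split n i ni (x i) (Ex i) _) _; last exact: ltrD.
have h1 := L0_funB (y n) (x i); have h2 := L0_funB (y n) z.
move/L0_leP: z_le0 => zl; have h3 := @L0_fun0 _ _ _ mu.
have /L0_ge0P xi0 := x0 i.
near=> t; rewrite (near h1 t)// (near h2 t)//.
have : L0_fun z t <= 0 by rewrite -[leRHS](near h3 t)//; near: t.
have : 0 <= L0_fun (x i) t by near: t.
have := ler_norm (- (L0_fun (y n) t - L0_fun (x i) t)); rewrite normrN.
have := ler_norm (L0_fun (y n) t - L0_fun z t).
set p := `|_|; set q := `|_|.
by move=> ? ? xit ?; rewrite (ger0_norm xit); lra.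
Unshelve. all: end_near. Qed.

End countably_coded_intervals.

Unset Implicit Arguments.
Set Strict Implicit.

Theorem theorem6p8 (R : realType) (X : ptopologicalType)
  (X_locally_compact : locally_compact [set: X])
  (X_hausdorff : hausdorff_space X)
  (X_compact_metrizable :
     forall K : set X, compact K -> metrizable R (set_type K))
  (mu : {measure set (borel X) -> \bar R})
  (E : banachFunctionSpace mu)
  (jCc_sub : range (@Cc_to_L0 X R mu) `<=` bfs_set E)
  (jCc_dense : is_dense_in (bfs_set E) (bfs_norm E) (range (@Cc_to_L0 X R mu))) :
  order_continuous E.
Proof.
apply: order_continuous_of_coded => u e Eu e0.
exact: interval_countable_code.
Qed.
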